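(* Let $R$ be a ring and let $\mathcal{AC}$ be the class of left $R$-modules satisfying the Auslander condition. Then each cycle of an exact complex of left $R$-modules with each term in $\mathcal{AC}$ belongs to $\mathcal{AC}$. That is, if $\cdots\to X_{n+1}\to X_n\xrightarrow{\partial_n}X_{n-1}\to\cdots$ ($n\in\mathbb{Z}$) is an exact complex of left $R$-modules with $X_n\in\mathcal{AC}$ for all $n$, then $\ker(\partial_n)\in\mathcal{AC}$ for all $n$.
   Context: Rings are associative with identity. For a left $R$-module $M$, let $0\to M\to E^0(M)\to E^1(M)\to\cdots\to E^i(M)\to\cdots$ be a minimal injective coresolution of $M$. The module $M$ satisfies the Auslander condition if the flat dimension of the left $R$-module $E^i(M)$ is at most $i$ for every $i\geqslant 0$. *)

(* Defs.v *)
From HB Require Import structures.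
From mathcomp Require Import all_boot all_order all_algebra.
From mathcomp Require Import boolp.
From mathcomp Require Import freeg.

Set Implicit Arguments.
Unset Strict Implicit.
Unset Printing Implicit Defensive.

Import GRing.Theory.
Local Open Scope ring_scope.
Local Open Scope quotient_scope.

(* [R : pzRingType] is an arbitrary ring with identity (the zero ring is      *)
(* allowed), [lmodType R] a left R-module, and [lmodType R^c] a right         *)
(* R-module: for [a : A] with [A : lmodType R^c], [r *: a] is the product a r.*)

(* A (x)_R M is the free abelian group on A x M modulo the subgroup generated *)
(* by the usual relators.                                                     *)
Section Tensor.
Context (R : pzRingType) (M : lmodType R).
Implicit Types A B : lmodType R^c.

Definition contains_relators A (S : {pred {freeg (A * M)%type / int}}) : Prop :=
  [/\ forall a a' m, << (a + a', m) >> - << (a, m) >> - << (a', m) >> \in S,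
      forall a m m', << (a, m + m') >> - << (a, m) >> - << (a, m') >> \in S
    & forall a (r : R) m, << ((r : R^c) *: a, m) >> - << (a, r *: m) >> \in S].

Definition relators A : {pred {freeg (A * M)%type / int}} :=
  fun x => `[< forall S : {pred {freeg (A * M)%type / int}},
                 zmod_closed S -> contains_relators S -> x \in S >].

Lemma relators_zmod_closed A : zmod_closed (@relators A).
Proof.
split=> [|x y /asboolP xS /asboolP yS]; apply/asboolP=> S clS relS.
  by case: clS.
by case: (clS) => _ -> //; [apply: xS | apply: yS].
Qed.

HB.instance Definition _ A :=
  GRing.isZmodClosed.Build _ (@relators A) (@relators_zmod_closed A).

Lemma relatorsP A : contains_relators (@relators A).
Proof.
by split=> *; apply/asboolP => S _ [rl rr rZ]; [apply: rl | apply: rr | apply: rZ].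
Qed.

Definition tensor A : zmodType := Quotient.quot (@relators A).

Definition tens A (a : A) (m : M) : tensor A :=
  \pi_(tensor A) (<< (a, m) >> : {freeg (A * M)%type / int}).

Section Functoriality.
Context (A B : lmodType R^c) (f : {linear A -> B}).

Definition free_map :
    {freeg (A * M)%type / int} -> {freeg (B * M)%type / int} :=
  fglift (fun am : A * M => << (f am.1, am.2) >>).

(* The map f (x) M; see [tensor_map_is_zmod_morphism] and [tensor_map_tens].  *)
Definition tensor_map (x : tensor A) : tensor B :=
  \pi_(tensor B) (free_map (repr x)).

Lemma free_map_is_zmod_morphism : zmod_morphism free_map.
Proof. exact: lift_is_additive. Qed.

Lemma free_mapU a m : free_map << (a, m) >> = << (f a, m) >>.
Proof. by rewrite /free_map liftU scale1r. Qed.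

Lemma pi_tensorE A' (x y : {freeg (A' * M)%type / int}) :
  x - y \in @relators A' -> \pi_(tensor A') x = \pi_(tensor A') y.
Proof. by rewrite Quotient.idealrBE => /eqP. Qed.

Lemma free_map_relators x :
  x \in @relators A -> free_map x \in @relators B.
Proof.
have fB := free_map_is_zmod_morphism.
have [rl rr rZ] := @relatorsP B.
pose S : {pred _} := fun y => free_map y \in @relators B.
have inS y : (y \in S) = (free_map y \in @relators B) by [].
move=> /asboolP /(_ S); rewrite inS; apply.
  split=> [|y z]; rewrite !inS.
    by rewrite -[X in free_map X](subrr 0) fB subrr rpred0.
  by rewrite fB; exact: rpredB.
split=> [a a' m|a m m'|a r m]; rewrite inS !fB !free_mapU ?linearD.
- exact: rl.
- exact: rr.
- by rewrite linearZ; exact: rZ.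
Qed.

Lemma tensor_map_pi x :
  tensor_map (\pi_(tensor A) x) = \pi_(tensor B) (free_map x).
Proof.
apply: pi_tensorE; rewrite -free_map_is_zmod_morphism.
by apply: free_map_relators; rewrite Quotient.idealrBE reprK.
Qed.

Lemma tensor_map_tens a m : tensor_map (tens a m) = tens (f a) m.
Proof. by rewrite tensor_map_pi free_mapU. Qed.

Lemma tensor_map_is_zmod_morphism : zmod_morphism tensor_map.
Proof.
move=> x y; rewrite -[x]reprK -[y]reprK.
by rewrite -raddfB !tensor_map_pi free_map_is_zmod_morphism raddfB.
Qed.

End Functoriality.
End Tensor.

Section Modules.
Context (R : pzRingType).
Implicit Types (L M N E : lmodType R).

Definition exact_at L M N (f : {linear L -> M}) (g : {linear M -> N}) : Prop :=
  forall y, g y = 0 <-> exists x, f x = y.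

Definition flat M : Prop :=
  forall (A B : lmodType R^c) (f : {linear A -> B}),
    injective f -> injective (tensor_map (M := M) f).

Definition flat_dim_le M (n : nat) : Prop :=
  exists (F : nat -> lmodType R) (d : forall i, {linear F i.+1 -> F i})
         (e : {linear F 0 -> M}),
    [/\ forall i, flat (F i),
        forall y, exists x, e x = y,
        exact_at (d 0) e,
        forall i, exact_at (d i.+1) (d i)
      & forall i, (n < i)%N -> forall x : F i, x = 0].

Definition injective_module E : Prop :=
  forall (A B : lmodType R) (f : {linear A -> B}) (g : {linear A -> E}),
    injective f -> exists h : {linear B -> E}, forall a, h (f a) = g a.

Definition essential_image M E (f : {linear M -> E}) : Prop :=
  forall S : {pred E}, GRing.submod_closed S ->
    (exists2 x, x \in S & x != 0) -> exists2 m, f m \in S & f m != 0.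

(* Minimality: E 0 is an injective envelope of M, and E i.+1 is an injective  *)
(* envelope of the image of d i, i.e. of the cokernel of the preceding map.   *)
Definition minimal_injective_coresolution M (E : nat -> lmodType R)
    (eta : {linear M -> E 0}) (d : forall i, {linear E i -> E i.+1}) : Prop :=
  [/\ forall i, injective_module (E i),
      injective eta,
      exact_at eta (d 0),
      forall i, exact_at (d i) (d i.+1)
    & essential_image eta /\ forall i, essential_image (d i)].

(* Minimal injective coresolutions exist and are unique up to isomorphism, so *)
(* the choice of one is immaterial.                                           *)
Definition auslander_condition M : Prop :=
  exists (E : nat -> lmodType R) (eta : {linear M -> E 0})
         (d : forall i, {linear E i -> E i.+1}),
    minimal_injective_coresolution eta d /\ forall i, flat_dim_le (E i) i.

End Modules.

Section Kernel.
Context (R : pzRingType) (M N : lmodType R) (f : {linear M -> N}).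

Definition ker_pred : {pred M} := fun x => f x == 0.

Lemma ker_submod_closed : GRing.submod_closed ker_pred.
Proof.
split=> [|a x y]; rewrite !unfold_in /ker_pred ?linear0 //.
by move=> /eqP fx /eqP fy; rewrite linearP fx fy scaler0 addr0.
Qed.

HB.instance Definition _ :=
  GRing.isSubmodClosed.Build R M ker_pred ker_submod_closed.

Definition kernel := {x : M | ker_pred x}.

HB.instance Definition _ := SubChoice.on kernel.
HB.instance Definition _ := [SubChoice_isSubLmodule of kernel by <:].

End Kernel.

(* Main.v *)
Require Import Defs.
From HB Require Import structures.
From mathcomp Require Import all_boot all_order all_algebra.
From mathcomp Require Import boolp classical_sets functions.
From mathcomp Require Import freeg.

Set Implicit Arguments.
Unset Strict Implicit.
Unset Printing Implicit Defensive.

Import GRing.Theory.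
Local Open Scope ring_scope.
Local Open Scope quotient_scope.

(** Write [Z n] for the kernel of [d n]. Exactness gives short exact sequences
    [0 -> Z -> X -> W -> 0] in which [Z] and [W] are consecutive kernels and
    [X] satisfies the Auslander condition. If [X] embeds in an injective [E]
    with cokernel [Q], then [Z] embeds in [E], and its cokernel is an extension
    of [Q] by [W]. Hence, by the horseshoe lemma, [Z] has an injective
    coresolution with terms [E^0(X)] and, for [i > 0],
    [E^i(X) * E^(i-1)(W)] ([bounded_coresolution_kernel]). The bound on flat
    dimensions is shifted by one for [W], so an induction on [k], carried out
    for all kernels at once, produces for each kernel an injective coresolution
    with [k] terms, the [i]-th of flat dimension at most [i].

    It remains to pass to minimal coresolutions. A module contained in an
    injective module has an injective hull, found by Zorn's lemma as a quotient
    of that injective module ([injective_hull]). The hull is a retract of every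
    injective module containing the given one, and likewise for the cokernels
    ([retract_hull]); so the minimal coresolution inherits the bounds
    ([bounded_coresolution_auslander]) provided that flat dimension does not
    increase along retracts ([flat_dim_retract]).

    Flat dimension is defined by the existence of a flat resolution, so this
    last point needs an argument: a module has flat dimension at most [n.+1] if
    and only if the kernel of its canonical free cover has flat dimension at
    most [n] ([flat_dim_syzygy]), and this kernel is functorial. The proof rests
    on the fact that the kernel of a surjection between flat modules is flat
    ([flat_kernel]), which follows from the purity of exact sequences ending in
    a flat module ([flat_pure]). *)

(** * Linear maps, kernels and quotients *)

Lemma quot_pi_eq0 (V : zmodType) (S : zmodClosed V) x :
  \pi_(Quotient.quot S) x = 0 <-> x \in S.
Proof.
rewrite -[X in _ = X <-> _](raddf0 (\pi_(Quotient.quot S))) -{2}[x]subr0.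
split=> [/eqP|xS]; first by rewrite -Quotient.idealrBE.
by apply/eqP; rewrite -Quotient.idealrBE.
Qed.

Section Modules.
Context (R : pzRingType).
Implicit Types K L M N P Q : lmodType R.

(** Bundles a function with a proof that it is linear. *)
Definition linear_of M N (f : M -> N) (f_lin : linear f) : {linear M -> N} :=
  HB.pack f (GRing.isLinear.Build R M N _ f f_lin).

Definition surjective M N (f : M -> N) : Prop := forall y, exists x, f x = y.

(** [M] is the kernel of [g : N -> P], [P] is its image: the sequence
    [0 -> M -> N -> P -> 0] is exact. *)
Definition short_exact M N P (f : {linear M -> N}) (g : {linear N -> P}) :=
  [/\ injective f, surjective g & exact_at f g].

Lemma inj_linear M N (f : {linear M -> N}) :
  (forall x, f x = 0 -> x = 0) -> injective f.
Proof.
by move=> f0 x y fxy; apply/subr0_eq/f0; rewrite linearB /= fxy subrr.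
Qed.

Lemma inj_linear0 M N (f : {linear M -> N}) x : injective f -> f x = 0 -> x = 0.
Proof. by move=> f_inj; rewrite -[X in _ = X -> _](linear0 f) => /f_inj. Qed.

Lemma exact_comp0 M N P (f : {linear M -> N}) (g : {linear N -> P}) x :
  exact_at f g -> g (f x) = 0.
Proof. by move=> fg; apply/fg; exists x. Qed.

(** The inclusion of the kernel. *)
Definition ker_incl M N (f : {linear M -> N}) : {linear kernel f -> M} :=
  val : kernel f -> M.

Lemma ker_incl_inj M N (f : {linear M -> N}) : injective (ker_incl f).
Proof. exact: val_inj. Qed.

Lemma ker_exact M N (f : {linear M -> N}) : exact_at (ker_incl f) f.
Proof.
move=> y; split=> [fy|[x <-]]; last exact/eqP/(valP x).
have y_ker : ker_pred f y by apply/eqP.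
by exists (Sub y y_ker : kernel f); exact: SubK.
Qed.

Lemma ker_short_exact M N (f : {linear M -> N}) :
  surjective f -> short_exact (ker_incl f) f.
Proof. by split; [exact: ker_incl_inj | | exact: ker_exact]. Qed.

(** Linear maps into the left end of an exact sequence. *)
Lemma exact_lift M N P L (f : {linear M -> N}) (g : {linear N -> P})
    (h : {linear L -> N}) :
  injective f -> exact_at f g -> (forall x, g (h x) = 0) ->
  exists k : {linear L -> M}, forall x, f (k x) = h x.
Proof.
move=> f_inj fg gh0.
have /choice[k fk] x : exists y, f y = h x by apply/fg.
have k_lin : linear k.
  by move=> a x y; apply: f_inj; rewrite linearP !fk linearP.
by exists (linear_of k_lin).
Qed.

(** Linear maps out of the right end of an exact sequence. *)
Lemma exact_factor M N P L (f : {linear M -> N}) (g : {linear N -> P})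
    (h : {linear N -> L}) :
  surjective g -> exact_at f g -> (forall x, h (f x) = 0) ->
  exists k : {linear P -> L}, forall x, k (g x) = h x.
Proof.
move=> /choice[s gs] fg hf0.
have hE x y : g x = g y -> h x = h y.
  move=> gxy; have /fg[z fz] : g (x - y) = 0 by rewrite linearB /= gxy subrr.
  by apply/subr0_eq; rewrite -linearB /= -fz hf0.
have k_lin : linear (h \o s).
  by move=> a x y; rewrite /= -linearP; apply: hE; rewrite linearP !gs.
by exists (linear_of k_lin) => x; apply: hE; rewrite gs.
Qed.

Section Quotient.
Context (M : lmodType R) (S : {pred M}) (S_clos : GRing.submod_closed S).

Let zS : zmodClosed M :=
  HB.pack S (GRing.isZmodClosed.Build M S (GRing.submod_closedB S_clos)).

(** The quotient of [M] by the submodule [S]. *)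
Definition lquot := Quotient.quot zS.
HB.instance Definition _ := GRing.Zmodule.on lquot.

Definition lquot_scale (a : R) (x : lquot) : lquot := \pi_lquot (a *: repr x).

Lemma lquot_scale_pi a x :
  lquot_scale a (\pi_lquot x) = \pi_lquot (a *: x).
Proof.
apply/eqP; rewrite -Quotient.idealrBE -scalerBr.
have xS : repr (\pi_lquot x) - x \in S.
  by rewrite -[S]/(zS : {pred M}) Quotient.idealrBE reprK.
by case: S_clos => S0 /(_ a _ _ xS S0); rewrite addr0.
Qed.

Lemma lquot_surj (x : lquot) : exists y, x = \pi_lquot y.
Proof. by exists (repr x); rewrite reprK. Qed.

Lemma lquot_scaleA a b x :
  lquot_scale a (lquot_scale b x) = lquot_scale (a * b) x.
Proof. by have [y ->] := lquot_surj x; rewrite !lquot_scale_pi scalerA. Qed.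

Lemma lquot_scale1 : left_id 1 lquot_scale.
Proof. by move=> x; have [y ->] := lquot_surj x; rewrite lquot_scale_pi scale1r. Qed.

Lemma lquot_scaleDr : right_distributive lquot_scale +%R.
Proof.
move=> a x y; have [u ->] := lquot_surj x; have [v ->] := lquot_surj y.
by rewrite -raddfD !lquot_scale_pi scalerDr raddfD.
Qed.

Lemma lquot_scaleDl x : {morph lquot_scale^~ x : a b / a + b}.
Proof.
have [y ->] := lquot_surj x; move=> a b.
by rewrite !lquot_scale_pi scalerDl raddfD.
Qed.

HB.instance Definition _ := GRing.Zmodule_isLmodule.Build R lquot
  lquot_scaleA lquot_scale1 lquot_scaleDr lquot_scaleDl.

Lemma pi_lquot_linear : linear (\pi_lquot : M -> lquot).
Proof.
by move=> a x y; rewrite raddfD; congr (_ + _); exact/esym/lquot_scale_pi.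
Qed.

End Quotient.

Lemma quotient_module M (S : {pred M}) : GRing.submod_closed S ->
  exists (Q : lmodType R) (q : {linear M -> Q}),
    surjective q /\ forall x, q x = 0 <-> x \in S.
Proof.
move=> S_clos.
exists (lquot S_clos), (linear_of (@pi_lquot_linear M S S_clos)).
split=> [y|x]; first by exists (repr y); rewrite /= reprK.
exact: (@quot_pi_eq0 M (HB.pack S
  (GRing.isZmodClosed.Build M S (GRing.submod_closedB S_clos)))).
Qed.

Lemma cokernel M N (f : {linear M -> N}) :
  exists (Q : lmodType R) (q : {linear N -> Q}), surjective q /\ exact_at f q.
Proof.
have [|Q [q [q_surj q0]]] :=
  @quotient_module N (fun y => `[< exists x, f x = y >]).
  split=> [|a _ _ /asboolP[x <-] /asboolP[y <-]]; apply/asboolP.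
    by exists 0; rewrite linear0.
  by exists (a *: x + y); rewrite linearP.
by exists Q, q; split=> // y; split=> [/q0/asboolP|?]; last exact/q0/asboolP.
Qed.

End Modules.

(** * Tensor products *)

Section TensorLift.
Context (R : pzRingType) (M : lmodType R) (A : lmodType R^c).

Lemma tens_surj (t : tensor M A) : exists D, t = \pi_(tensor M A) D.
Proof. by exists (repr t); rewrite reprK. Qed.

(** The elementary tensors generate the tensor product. *)
Lemma tensor_ind (T : tensor M A -> Prop) :
  T 0 -> (forall x y, T x -> T y -> T (x - y)) -> (forall a m, T (tens a m)) ->
  forall t, T t.
Proof.
move=> T0 TB Tt t.
have TN x : T x -> T (- x) by move=> Tx; rewrite -sub0r; exact: TB.
have TD x y : T x -> T y -> T (x + y).
  by move=> Tx Ty; rewrite -[y]opprK; apply: TB => //; exact: TN.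
have [D ->] := tens_surj t.
rewrite -[D]freeg_sumE raddf_sum /=; apply: big_ind => // -[a m] _.
have -> : << coeff (a, m) D *g (a, m) >> =
    << (a, m) >> *~ coeff (a, m) D :> {freeg (A * M)%type / int}.
  by rewrite -[LHS]/(<< coeff (a, m) D *g (a, m) >>) -[X in << X *g _ >>]intz freegU_mulz.
have Tn n x : T x -> T (x *+ n).
  by move=> Tx; elim: n => [|n IHn]; rewrite ?mulrS; [|exact: TD].
rewrite raddfMz; case: (coeff _ _) => n; rewrite ?NegzE -?nmulrn -?pmulrn.
  exact: Tn (Tt a m).
exact/TN/Tn/Tt.
Qed.

Lemma tensor_ext (Z : zmodType) (f g : {additive tensor M A -> Z}) :
  (forall a m, f (tens a m) = g (tens a m)) -> f =1 g.
Proof.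
move=> fg; apply: tensor_ind => // [|x y fgx fgy]; first by rewrite !raddf0.
by rewrite !raddfB fgx fgy.
Qed.

Lemma tensDl a b m : tens (a + b) m = tens a m + tens b m :> tensor M A.
Proof.
case: (@relatorsP R M A) => /(_ a b m) rel _ _.
apply/eqP; rewrite -subr_eq0 opprD addrA -!raddfB -(raddf0 \pi).
by rewrite -Quotient.idealrBE subr0.
Qed.

Lemma tensDr a m n : tens a (m + n) = tens a m + tens a n :> tensor M A.
Proof.
case: (@relatorsP R M A) => _ /(_ a m n) rel _.
apply/eqP; rewrite -subr_eq0 opprD addrA -!raddfB -(raddf0 \pi).
by rewrite -Quotient.idealrBE subr0.
Qed.

Lemma tensZ a (r : R) m : tens ((r : R^c) *: a) m = tens a (r *: m) :> tensor M A.
Proof.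
by case: (@relatorsP R M A) => _ _ /(_ a r m) rel; exact: pi_tensorE.
Qed.

Lemma tens0l m : tens 0 m = 0 :> tensor M A.
Proof. by apply: (addrI (tens 0 m)); rewrite -tensDl !addr0. Qed.

Lemma tens0r a : tens a 0 = 0 :> tensor M A.
Proof. by apply: (addrI (tens a 0)); rewrite -tensDr !addr0. Qed.

Lemma tensBl a b m : tens (a - b) m = tens a m - tens b m :> tensor M A.
Proof. by apply/eqP; rewrite eq_sym subr_eq -tensDl subrK. Qed.

Lemma tensBr a m n : tens a (m - n) = tens a m - tens a n :> tensor M A.
Proof. by apply/eqP; rewrite eq_sym subr_eq -tensDr subrK. Qed.

(** The universal property of the tensor product: a balanced biadditive map
    extends to an additive map. *)
Lemma tensor_lift (Z : zmodType) (phi : A -> M -> Z) :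
    (forall a b m, phi (a + b) m = phi a m + phi b m) ->
    (forall a m n, phi a (m + n) = phi a m + phi a n) ->
    (forall a (r : R) m, phi ((r : R^c) *: a) m = phi a (r *: m)) ->
  exists psi : {additive tensor M A -> Z}, forall a m, psi (tens a m) = phi a m.
Proof.
move=> phiDl phiDr phiZ.
pose F : _ -> Z := fglift (fun am : A * M => phi am.1 am.2 : zmodule Z).
have FB : zmod_morphism F := @lift_is_additive _ _ (zmodule Z) _.
have FU a m : F << (a, m) >> = phi a m by rewrite /F liftU scale1r.
have F0 : F 0 = 0 by rewrite -[X in F X](subrr 0) FB subrr.
have Frel x : x \in @relators R M A -> F x = 0.
  move=> /asboolP /(_ (fun y => F y == 0)) => H; apply/eqP; apply: H.
    split=> [|y z]; rewrite !unfold_in ?F0 //.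
    by move=> /eqP Fy /eqP Fz; rewrite FB Fy Fz subrr.
  split=> [a b m|a m n|a r m]; rewrite unfold_in !FB !FU -?addrA -?opprD subr_eq0.
  - by rewrite phiDl.
  - by rewrite phiDr.
  - by rewrite phiZ.
pose psi (t : tensor M A) : Z := F (repr t).
have psi_pi x : psi (\pi_(tensor M A) x) = F x.
  apply/eqP; rewrite -subr_eq0 /psi -[X in X == _]FB; apply/eqP/Frel.
  by rewrite Quotient.idealrBE reprK.
have psiB : zmod_morphism psi.
  move=> s t; have [x ->] := tens_surj s; have [y ->] := tens_surj t.
  by rewrite -raddfB !psi_pi FB.
pose psi' : {additive tensor M A -> Z} :=
  HB.pack psi (GRing.isZmodMorphism.Build _ _ psi psiB).
by exists psi' => a m; rewrite /= psi_pi FU.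
Qed.

End TensorLift.

Section TensorBifunctor.
Context (R : pzRingType).
Implicit Types (K L M N : lmodType R) (A B C D : lmodType R^c).

Lemma tmap_exists M N A B (h : {linear A -> B}) (g : {linear M -> N}) :
  exists psi : {additive tensor M A -> tensor N B},
    forall a m, psi (tens a m) = tens (h a) (g m).
Proof.
apply: (@tensor_lift R M A _ (fun a m => tens (h a) (g m))) => [a b m|a m n|a r m].
- by rewrite linearD tensDl.
- by rewrite linearD tensDr.
- by rewrite !linearZ tensZ.
Qed.

(** The map [h (x) g] induced on tensor products. *)
Definition tmap M N A B (h : {linear A -> B}) (g : {linear M -> N}) :
    {additive tensor M A -> tensor N B} :=
  sval (cid (tmap_exists h g)).

Lemma tmap_tens M N A B (h : {linear A -> B}) (g : {linear M -> N}) a m :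
  tmap h g (tens a m) = tens (h a) (g m).
Proof. exact: (svalP (cid (tmap_exists h g))). Qed.

Lemma tmap_comp M N K A B C (h : {linear A -> B}) (h' : {linear B -> C})
    (g : {linear M -> N}) (g' : {linear N -> K}) t :
  tmap h' g' (tmap h g t) = tmap (h' \o h) (g' \o g) t.
Proof.
by move: t; apply: (tensor_ext (f := tmap h' g' \o tmap h g)) => a m /=;
   rewrite !tmap_tens.
Qed.

Lemma eq_tmap M N A B (h h' : {linear A -> B}) (g g' : {linear M -> N}) :
  h =1 h' -> g =1 g' -> tmap h g =1 tmap h' g'.
Proof. by move=> hh gg; apply: tensor_ext => a m; rewrite !tmap_tens hh gg. Qed.

Lemma tmap_id M A (h : {linear A -> A}) (g : {linear M -> M}) :
  h =1 id -> g =1 id -> tmap h g =1 id.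
Proof.
move=> h1 g1; apply: (tensor_ext (g := idfun)) => a m.
by rewrite tmap_tens h1 g1.
Qed.

Lemma tmap0 M N A B (h : {linear A -> B}) (g : {linear M -> N}) :
  (forall a, h a = 0) \/ (forall m, g m = 0) -> forall t, tmap h g t = 0.
Proof.
move=> hg; apply: tensor_ind => [|x y hx hy|a m]; first exact: raddf0.
  by rewrite raddfB hx hy subrr.
by rewrite tmap_tens; case: hg => ->; rewrite ?tens0l ?tens0r.
Qed.

Lemma tensor_mapE M A B (f : {linear A -> B}) (t : tensor M A) :
  tensor_map f t = tmap f (idfun : {linear M -> M}) t.
Proof.
pose F : {additive tensor M A -> tensor M B} :=
  HB.pack (tensor_map f) (GRing.isZmodMorphism.Build _ _ (tensor_map f)
    (@tensor_map_is_zmod_morphism R M A B f)).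
move: t; apply: (tensor_ext (f := F)) => a m.
by rewrite /= tmap_tens tensor_map_tens.
Qed.

Lemma flatP M : flat M <-> forall A B (f : {linear A -> B}), injective f ->
  forall t, tmap f (idfun : {linear M -> M}) t = 0 -> t = 0.
Proof.
split=> [M_flat A B f f_inj t ft|M_flat A B f f_inj x y].
  apply: (M_flat _ _ _ f_inj); rewrite !tensor_mapE ft.
  by rewrite raddf0.
rewrite !tensor_mapE => /eqP; rewrite -subr_eq0 -raddfB => /eqP /M_flat.
by move=> /(_ f_inj) /subr0_eq.
Qed.

(** Right exactness in both variables at once: if [h] and [g] are surjective,
    the kernel of [h (x) g] is generated by the elementary tensors with one
    factor in [ker h] or in [ker g]. *)
Lemma tmap_ker M N A B (h : {linear A -> B}) (g : {linear M -> N})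
    (S : {pred tensor M A}) :
  surjective h -> surjective g -> zmod_closed S ->
  (forall a m, h a = 0 -> tens a m \in S) ->
  (forall a m, g m = 0 -> tens a m \in S) ->
  forall t, tmap h g t = 0 -> t \in S.
Proof.
move=> /choice[u hu] /choice[v gv] S_clos hS gS.
pose zS : zmodClosed (tensor M A) :=
  HB.pack S (GRing.isZmodClosed.Build (tensor M A) S S_clos).
pose Q : zmodType := Quotient.quot zS.
have piQ0 t : \pi_Q t = 0 <-> t \in S by exact: (quot_pi_eq0 zS).
have piQ a b m n : h a = h b -> g m = g n ->
    \pi_Q (tens a m) = \pi_Q (tens b n).
  move=> hab gmn; apply/subr0_eq; rewrite -raddfB; apply/piQ0.
  have -> : tens a m - tens b n = tens (a - b) m + tens b (m - n).
    by rewrite tensBl tensBr addrA subrK.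
  rewrite -[S]/(zS : {pred _}) rpredD //.
    by apply: hS; rewrite linearB /= hab subrr.
  by apply: gS; rewrite linearB /= gmn subrr.
(* the inverse of the map induced by [h (x) g] on the quotient by [S] *)
have [|||psi psiE] := @tensor_lift R N B Q (fun b n => \pi_Q (tens (u b) (v n))).
- move=> b b' n; rewrite -raddfD -tensDl.
  by apply: piQ; rewrite // linearD /= !hu.
- move=> b n n'; rewrite -raddfD -tensDr.
  by apply: piQ; rewrite // linearD /= !gv.
- move=> b r n; rewrite (piQ _ ((r : R^c) *: u b) _ (v n)) //; last first.
    by rewrite linearZ /= !hu.
  by rewrite tensZ; apply: piQ; rewrite // linearZ /= !gv.
have psi_tmap : forall t, psi (tmap h g t) = \pi_Q t.
  apply: (tensor_ext (f := psi \o tmap h g) (g := \pi_Q)) => a m.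
  by rewrite /= tmap_tens psiE; apply: piQ; rewrite ?hu ?gv.
by move=> t gt; apply/piQ0; rewrite -psi_tmap gt raddf0.
Qed.

(** The image of [f], as a boolean predicate. *)
Definition im_pred (U V : zmodType) (f : U -> V) : {pred V} :=
  fun y => `[< exists x, f x = y >].

Lemma im_zmod_closed (U V : zmodType) (f : {additive U -> V}) :
  zmod_closed (im_pred f).
Proof.
split=> [|_ _ /asboolP[x <-] /asboolP[y <-]]; apply/asboolP.
  by exists 0; rewrite raddf0.
by exists (x - y); rewrite raddfB.
Qed.

Lemma tensor_right_exact_r M N K (f : {linear M -> N}) (g : {linear N -> K}) A
    (t : tensor N A) :
  surjective g -> exact_at f g ->
  tmap (idfun : {linear A -> A}) g t = 0 ->
  exists s : tensor M A, tmap (idfun : {linear A -> A}) f s = t.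
Proof.
move=> g_surj fg gt; apply/asboolP.
apply: (tmap_ker (S := im_pred (tmap (idfun : {linear A -> A}) f))) gt => //.
- by move=> a; exists a.
- exact: im_zmod_closed.
- by move=> a m /= ->; apply/asboolP; exists 0; rewrite raddf0 tens0l.
- by move=> a m /fg[x <-]; apply/asboolP; exists (tens a x); rewrite tmap_tens.
Qed.

Lemma tensor_right_exact_l A B C (f : {linear A -> B}) (g : {linear B -> C}) M
    (t : tensor M B) :
  surjective g -> exact_at f g ->
  tmap g (idfun : {linear M -> M}) t = 0 ->
  exists s : tensor M A, tmap f (idfun : {linear M -> M}) s = t.
Proof.
move=> g_surj fg gt; apply/asboolP.
apply: (tmap_ker (S := im_pred (tmap f (idfun : {linear M -> M})))) gt => //.
- by move=> a; exists a.
- exact: im_zmod_closed.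
- by move=> a m /fg[x <-]; apply/asboolP; exists (tens x m); rewrite tmap_tens.
- by move=> a m /= ->; apply/asboolP; exists 0; rewrite raddf0 tens0r.
Qed.

Lemma tmap_surj M N A B (h : {linear A -> B}) (g : {linear M -> N}) :
  surjective h -> surjective g -> forall t, exists s, tmap h g s = t.
Proof.
move=> h_surj g_surj; apply: tensor_ind => [|x y [s <-] [s' <-]|b n].
- by exists 0; rewrite raddf0.
- by exists (s - s'); rewrite raddfB.
- have [[a <-] [m <-]] := (h_surj b, g_surj n).
  by exists (tens a m); rewrite tmap_tens.
Qed.

End TensorBifunctor.

(** * Free modules *)

Section FreeModule.
Context (R : pzRingType) (T : choiceType).

Definition finsupp_pred : {pred T -> R^o} :=
  fun f => `[< exists s : seq T, forall t, t \notin s -> f t = 0 >].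

Lemma finsupp_submod_closed : GRing.submod_closed finsupp_pred.
Proof.
split=> [|a f g /asboolP[s fs] /asboolP[s' gs]]; apply/asboolP.
  by exists [::].
exists (s ++ s') => t; rewrite mem_cat => /norP[ts ts'].
by rewrite -[LHS]/(a * f t + g t) fs // gs // addr0 mulr0.
Qed.

HB.instance Definition _ :=
  GRing.isSubmodClosed.Build R (T -> R^o) finsupp_pred finsupp_submod_closed.

(** The free left module on [T], realized as the finitely supported functions
    from [T] to [R]. *)
Definition free_module := {f : T -> R^o | finsupp_pred f}.

HB.instance Definition _ := SubChoice.on free_module.
HB.instance Definition _ := [SubChoice_isSubLmodule of free_module by <:].

Implicit Types (x y : free_module) (t : T) (s : seq T).

(** The coefficient of [x] at [t]. *)
Definition fcoef x t : R := val x t.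

Lemma fcoefP a x y t : fcoef (a *: x + y) t = a * fcoef x t + fcoef y t.
Proof. by []. Qed.

Lemma fcoef_inj x y : fcoef x =1 fcoef y -> x = y.
Proof. by move=> xy; apply/val_inj/funext. Qed.

(** The coefficients of [x] vanish outside [s]. *)
Definition supports s x := forall t, t \notin s -> fcoef x t = 0.

Lemma exists_support x : exists2 s, uniq s & supports s x.
Proof.
have /asboolP[s xs] := valP x; exists (undup s); first exact: undup_uniq.
by move=> t; rewrite mem_undup; apply: xs.
Qed.

Lemma delta_proof t : finsupp_pred (fun u => (u == t)%:R : R^o).
Proof.
by apply/asboolP; exists [:: t] => u; rewrite inE => /negbTE ->.
Qed.

(** The basis element indexed by [t]. *)
Definition fdelta t : free_module := Sub _ (delta_proof t).

Lemma fcoef_delta t u : fcoef (fdelta t) u = (u == t)%:R.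
Proof. by rewrite /fcoef SubK. Qed.

Lemma free_decomp s x : uniq s -> supports s x ->
  x = \sum_(t <- s) fcoef x t *: fdelta t.
Proof.
move=> s_uniq xs; apply: fcoef_inj => u.
have fcoef_sum (r : seq T) : fcoef (\sum_(t <- r) fcoef x t *: fdelta t) u =
    \sum_(t <- r) fcoef x t * (u == t)%:R.
  elim: r => [|t r IHr]; first by rewrite !big_nil.
  by rewrite !big_cons fcoefP fcoef_delta IHr.
rewrite fcoef_sum; have [us|us] := boolP (u \in s).
  rewrite (bigD1_seq u) //= eqxx mulr1 big1 ?addr0 // => t tu.
  by rewrite eq_sym (negbTE tu) mulr0.
rewrite xs // big1_seq // => t /= ts; have [ut|] := eqVneq u t.
  by rewrite ut ts in us.
by rewrite mulr0.
Qed.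

Section Lift.
Context (M : lmodType R) (g : T -> M).

Lemma sum_support s s' x : uniq s -> uniq s' -> supports s x -> supports s' x ->
  \sum_(t <- s) fcoef x t *: g t = \sum_(t <- s') fcoef x t *: g t.
Proof.
have restr r : \sum_(t <- r) fcoef x t *: g t =
    \sum_(t <- [seq t <- r | fcoef x t != 0]) fcoef x t *: g t.
  rewrite big_filter [RHS]big_mkcond; apply: eq_bigr => t _.
  by have [->|] := eqVneq (fcoef x t) 0; rewrite ?scale0r.
move=> s_uniq s'_uniq xs xs'; rewrite restr [RHS]restr; apply: perm_big.
apply: uniq_perm; rewrite ?filter_uniq // => t; rewrite !mem_filter.
apply: andb_id2l => x_t; apply/idP/idP => _; apply: contraNT x_t.
  by move=> /xs' ->.
by move=> /xs ->.
Qed.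

(** The universal property of the free module. *)
Lemma free_lift : exists f : {linear free_module -> M}, forall t, f (fdelta t) = g t.
Proof.
have /choice[s sP] x : exists s, uniq s /\ supports s x.
  by have [s] := exists_support x; exists s.
pose f x := \sum_(t <- s x) fcoef x t *: g t.
have fE r x : uniq r -> supports r x -> f x = \sum_(t <- r) fcoef x t *: g t.
  by have [? ?] := sP x; move=> ? ?; apply: sum_support.
have f_lin : linear f.
  move=> a x y; have [_ xs] := sP x; have [_ ys] := sP y.
  pose r := undup (s x ++ s y).
  have supp z w : supports (s z) z -> {subset s z <= s x ++ s y} ->
      w = z -> supports r w.
    by move=> zs zr -> t; rewrite mem_undup => tr; apply/zs/(contra (zr t)).
  have rx : supports r x by apply: (supp x) => // t tx; rewrite mem_cat tx.
  have ry : supports r y by apply: (supp y) => // t ty; rewrite mem_cat ty orbT.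
  have rxy : supports r (a *: x + y).
    by move=> t tr; rewrite fcoefP rx // ry // mulr0 addr0.
  rewrite !(@fE r) ?undup_uniq // scaler_sumr -big_split /=.
  by apply: eq_bigr => t _; rewrite fcoefP scalerDl scalerA.
exists (linear_of f_lin) => t.
rewrite /= (fE [:: t]) //.
  by rewrite big_seq1 fcoef_delta eqxx scale1r.
by move=> u; rewrite inE fcoef_delta => /negbTE ->.
Qed.

Lemma free_ext (f f' : {linear free_module -> M}) :
  (forall t, f (fdelta t) = f' (fdelta t)) -> f =1 f'.
Proof.
move=> ff' x; have [s s_uniq xs] := exists_support x.
rewrite (free_decomp s_uniq xs) !linear_sum; apply: eq_bigr => t _.
by rewrite !linearZ /= ff'.
Qed.

End Lift.

(** Free modules are projective. *)
Lemma free_projective (P M : lmodType R) (p : {linear P -> M})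
    (f : {linear free_module -> M}) : surjective p ->
  exists g : {linear free_module -> P}, forall x, p (g x) = f x.
Proof.
move=> /choice[s ps].
have [g gE] := free_lift (fun t => s (f (fdelta t))); exists g.
by apply: (free_ext (f := p \o g)) => t /=; rewrite gE ps.
Qed.

End FreeModule.

(** The canonical free cover of [M]. *)
Lemma free_cover (R : pzRingType) (M : lmodType R) :
  exists p : {linear free_module R M -> M}, surjective p.
Proof.
by have [p pE] := free_lift (id : M -> M); exists p => m; exists (fdelta R m).
Qed.

(** * Flat modules *)

Section FreeTensor.
Context (R : pzRingType) (T : choiceType).

(** An element of [A (x) F], with [F] free on [T], is determined by its
    coefficients [a_t] in the expression [\sum_t a_t (x) t], and taking
    coefficients is natural in [A]. *)
Lemma free_flat : flat (free_module R T).
Proof.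
pose F := free_module R T.
have coef_ex (A : lmodType R^c) k : exists c : {additive tensor F A -> A},
    forall a x, c (tens a x) = (fcoef x k : R^c) *: a.
  apply: tensor_lift => [a b x|a x y|a r x].
  - by rewrite scalerDr.
  - by rewrite -scalerDl.
  - by rewrite scalerA.
have decomp (A : lmodType R^c) (c : T -> {additive tensor F A -> A}) :
    (forall k a x, c k (tens a x) = (fcoef x k : R^c) *: a) ->
    forall t : tensor F A, exists s : seq T, forall s', uniq s' -> {subset s <= s'} ->
      t = \sum_(k <- s') tens (c k t) (fdelta R k).
  move=> cE; apply: tensor_ind => [|t u [s ts] [s' us']|a x].
  - exists [::] => s _ _; rewrite big1 // => k _.
    by rewrite raddf0 tens0l.
  - exists (s ++ s') => r r_uniq sr.
    have sr1 : {subset s <= r} by move=> k ks; apply: sr; rewrite mem_cat ks.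
    have sr2 : {subset s' <= r}.
      by move=> k ks; apply: sr; rewrite mem_cat ks orbT.
    under eq_bigr do rewrite raddfB tensBl.
    by rewrite sumrB -(ts r) // -(us' r).
  have [s s_uniq xs] := exists_support x; exists s => s' s'_uniq ss'.
  have xs' : supports s' x by move=> k ks'; apply/xs/(contra (ss' k)).
  rewrite [in LHS](free_decomp s'_uniq xs').
  pose tensa : F -> tensor F A := tens a.
  have tensaD : {morph tensa : y z / y + z} by move=> y z; exact: tensDr.
  rewrite -/(tensa _) (big_morph tensa tensaD (tens0r _ _)).
  by apply: eq_bigr => k _; rewrite cE tensZ.
apply/flatP => A B f f_inj t ft.
have /choice[c cE] := coef_ex A; have /choice[c' c'E] := coef_ex B.
have c0 k : c k t = 0.
  apply: (inj_linear0 f_inj).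
  have <- : c' k (tmap f (idfun : {linear F -> F}) t) = f (c k t).
    move: t {ft}; apply: (tensor_ext
      (f := c' k \o tmap f (idfun : {linear F -> F})) (g := f \o c k)) => a x.
    by rewrite /= tmap_tens c'E cE linearZ.
  by rewrite ft raddf0.
have [s ts] := decomp A c cE t.
rewrite (ts (undup s)) ?undup_uniq //.
  by rewrite big1 // => k _; rewrite c0 tens0l.
by move=> k; rewrite mem_undup.
Qed.

(** Free right modules are flat as well: here the free module is the left
    tensor factor. *)
Lemma free_flat_right (M N : lmodType R) (g : {linear M -> N}) : injective g ->
  forall t, tmap (idfun : {linear free_module R^c T -> free_module R^c T}) g t = 0 ->
  t = 0.
Proof.
pose F := free_module R^c T.
have coef_ex (A : lmodType R) k : exists c : {additive tensor A F -> A},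
    forall x a, c (tens x a) = (fcoef x k : R) *: a.
  apply: tensor_lift => [x y a|x a b|x r a].
  - by rewrite -scalerDl.
  - by rewrite scalerDr.
  - by rewrite scalerA.
have decomp (A : lmodType R) (c : T -> {additive tensor A F -> A}) :
    (forall k x a, c k (tens x a) = (fcoef x k : R) *: a) ->
    forall t : tensor A F, exists s : seq T, forall s', uniq s' -> {subset s <= s'} ->
      t = \sum_(k <- s') tens (fdelta R^c k) (c k t).
  move=> cE; apply: tensor_ind => [|t u [s ts] [s' us']|x a].
  - exists [::] => s _ _; rewrite big1 // => k _.
    by rewrite raddf0 tens0r.
  - exists (s ++ s') => r r_uniq sr.
    have sr1 : {subset s <= r} by move=> k ks; apply: sr; rewrite mem_cat ks.
    have sr2 : {subset s' <= r}.
      by move=> k ks; apply: sr; rewrite mem_cat ks orbT.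
    under eq_bigr do rewrite raddfB tensBr.
    by rewrite sumrB -(ts r) // -(us' r).
  have [s s_uniq xs] := exists_support x; exists s => s' s'_uniq ss'.
  have xs' : supports s' x by move=> k ks'; apply/xs/(contra (ss' k)).
  rewrite [in LHS](free_decomp s'_uniq xs').
  pose tensa : F -> tensor A F := fun y => tens y a.
  have tensaD : {morph tensa : y z / y + z} by move=> y z; exact: tensDl.
  rewrite -/(tensa _) (big_morph tensa tensaD (tens0l _ _)).
  by apply: eq_bigr => k _; rewrite cE -tensZ.
move=> g_inj t gt.
have /choice[c cE] := coef_ex M; have /choice[c' c'E] := coef_ex N.
have c0 k : c k t = 0.
  apply: (inj_linear0 g_inj).
  have <- : c' k (tmap (idfun : {linear F -> F}) g t) = g (c k t).
    move: t {gt}; apply: (tensor_ext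
      (f := c' k \o tmap (idfun : {linear F -> F}) g) (g := g \o c k)) => x a.
    by rewrite /= tmap_tens c'E cE linearZ.
  by rewrite gt raddf0.
have [s ts] := decomp M c cE t.
rewrite (ts (undup s)) ?undup_uniq //.
  by rewrite big1 // => k _; rewrite c0 tens0r.
by move=> k; rewrite mem_undup.
Qed.

End FreeTensor.

Section Flat.
Context (R : pzRingType).
Implicit Types (K L M N P : lmodType R) (A B C D : lmodType R^c).

(** [M] is a direct summand of [N] up to isomorphism. *)
Definition retract M N : Prop :=
  exists (i : {linear M -> N}) (p : {linear N -> M}), forall x, p (i x) = x.

Lemma flat_retract M N : retract M N -> flat N -> flat M.
Proof.
move=> [i [p pi]] /flatP N_flat; apply/flatP => A B f f_inj t ft.
pose iA := tmap (idfun : {linear A -> A}) i.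
have <- : tmap (idfun : {linear A -> A}) p (iA t) = t.
  by rewrite tmap_comp; apply: tmap_id.
suff -> : iA t = 0 by rewrite raddf0.
apply: (N_flat _ _ _ f_inj); rewrite tmap_comp.
have -> : tmap (f \o idfun) (idfun \o i) t =
    tmap (idfun : {linear B -> B}) i (tmap f (idfun : {linear M -> M}) t).
  by rewrite tmap_comp; apply: eq_tmap.
by rewrite ft raddf0.
Qed.


Definition fst_lin M N : {linear (M * N)%type -> M} :=
  linear_of (fun a (x y : M * N) => erefl ((a *: x + y).1)).

Definition snd_lin M N : {linear (M * N)%type -> N} :=
  linear_of (fun a (x y : M * N) => erefl ((a *: x + y).2)).

Lemma linear_pair K M N (f : {linear K -> M}) (g : {linear K -> N}) :
  linear (fun x => (f x, g x)).
Proof. by move=> a x y; rewrite !linearP. Qed.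

Definition pair_lin K M N (f : {linear K -> M}) (g : {linear K -> N}) :
  {linear K -> (M * N)%type} := linear_of (linear_pair f g).

Definition inl_lin M N : {linear M -> (M * N)%type} :=
  pair_lin (idfun : {linear M -> M}) (\0 : {linear M -> N}).

Definition inr_lin M N : {linear N -> (M * N)%type} :=
  pair_lin (\0 : {linear N -> M}) (idfun : {linear N -> N}).

Lemma flat_prod M N : flat M -> flat N -> flat (M * N)%type.
Proof.
move=> /flatP M_flat /flatP N_flat; apply/flatP => A B f f_inj t ft.
have proj0 K (p : {linear (M * N)%type -> K}) :
    (forall A B (f : {linear A -> B}), injective f ->
      forall t, tmap f (idfun : {linear K -> K}) t = 0 -> t = 0) ->
    tmap (idfun : {linear A -> A}) p t = 0.
  move=> K_flat; apply: (K_flat _ _ _ f_inj).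
  rewrite tmap_comp -[RHS](raddf0 (tmap (idfun : {linear B -> B}) p)) -ft.
  by rewrite tmap_comp; apply: eq_tmap.
have -> : t = tmap (idfun : {linear A -> A}) (inl_lin M N)
                (tmap (idfun : {linear A -> A}) (fst_lin M N) t)
            + tmap (idfun : {linear A -> A}) (inr_lin M N)
                (tmap (idfun : {linear A -> A}) (snd_lin M N) t).
  rewrite !tmap_comp; set F := tmap _ _; set G := tmap _ _.
  move: t {ft proj0}; apply: (tensor_ext (f := idfun) (g := F \+ G)) => a m.
  rewrite /= !tmap_tens -tensDr; congr tens.
  by case: m => x y; rewrite -[RHS]/(x + 0, 0 + y) addr0 add0r.
by rewrite !proj0 // !raddf0 addr0.
Qed.

(** Exact sequences ending in a flat module are pure, i.e. stay exact under
    every tensor product. This is a diagram chase on a free cover of the other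
    tensor factor [A]. *)
Lemma flat_pure K M N (f : {linear K -> M}) (g : {linear M -> N}) A :
  short_exact f g -> flat N ->
  forall t : tensor K A, tmap (idfun : {linear A -> A}) f t = 0 -> t = 0.
Proof.
move=> [f_inj g_surj fg] /flatP N_flat t ft.
have [h h_surj] := free_cover A; pose l := ker_incl h.
have id_surj L : surjective (idfun : {linear L -> L}) by move=> x; exists x.
have [t' ht'] := tmap_surj h_surj (id_surj K) t.
pose b := tmap idfun f t'.
have /(tensor_right_exact_l h_surj (@ker_exact _ _ _ h)) [u lu] :
    tmap h (idfun : {linear M -> M}) b = 0.
  rewrite /b tmap_comp -ft -ht' tmap_comp; exact: eq_tmap.
have /(tensor_right_exact_r g_surj fg) [w fw] : tmap idfun g u = 0.
  apply: (N_flat _ _ _ (@ker_incl_inj _ _ _ h)).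
  have -> : tmap (ker_incl h) (idfun : {linear N -> N}) (tmap idfun g u) =
      tmap idfun g (tmap (ker_incl h) (idfun : {linear M -> M}) u).
    by rewrite !tmap_comp; apply: eq_tmap.
  rewrite lu /b tmap_comp; apply: tmap0; right=> x /=.
  exact: exact_comp0.
have t'E : t' = tmap l (idfun : {linear K -> K}) w.
  apply/subr0_eq/(free_flat_right f_inj); rewrite raddfB -/b -lu -fw !tmap_comp.
  by apply/eqP; rewrite subr_eq0; apply/eqP/eq_tmap.
rewrite -ht' t'E tmap_comp; apply: tmap0; left=> x /=.
exact: (exact_comp0 _ (@ker_exact _ _ _ h)).
Qed.

Lemma flat_kernel K M N (f : {linear K -> M}) (g : {linear M -> N}) :
  short_exact f g -> flat M -> flat N -> flat K.
Proof.
move=> fg /flatP M_flat N_flat; apply/flatP => A B h h_inj t ht.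
apply: (flat_pure fg N_flat); apply: (M_flat _ _ _ h_inj).
rewrite tmap_comp -[RHS](raddf0 (tmap (idfun : {linear B -> B}) f)) -ht.
by rewrite tmap_comp; apply: eq_tmap.
Qed.

End Flat.

(** * Flat dimension *)

Section FlatDimension.
Context (R : pzRingType).
Implicit Types (K L M N P : lmodType R).


Lemma flat_dim0P M : flat_dim_le M 0 <-> flat M.
Proof.
split=> [[F [d [e [F_flat e_surj de _ F0]]]]|M_flat].
  apply: flat_retract (F_flat 0).
  have e_inj x : e x = 0 -> x = 0.
    by move=> /de[y <-]; rewrite (F0 1 isT y) linear0.
  have /choice[s es] := e_surj.
  have s_lin : linear s.
    move=> a x y; apply/subr0_eq/e_inj.
    by rewrite linearB linearP !es subrr.
  by exists (linear_of s_lin), e => x; exact: es.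
pose F i : lmodType R := if i is 0%N then M else kernel (idfun : {linear M -> M}).
have F0 i : (0 < i)%N -> forall x : F i, x = 0.
  by case: i => // i _ x; apply/val_inj/(eqP (valP x)).
exists F, (fun i => \0), (idfun : {linear F 0%N -> M}); split=> //.
- case=> // i; apply: flat_retract M_flat.
  by exists \0, \0 => x; rewrite [RHS](F0 i.+1).
- by move=> y; exists y.
- move=> y; split=> [/= ->|[x <-] //]; by exists 0.
- by move=> i y; split=> // _; exists 0; rewrite [RHS](F0 i.+1).
Qed.

Lemma flat_dimSP M n : flat_dim_le M n.+1 <->
  exists K P (i : {linear K -> P}) (p : {linear P -> M}),
    [/\ short_exact i p, flat P & flat_dim_le K n].
Proof.
split=> [[F [d [e [F_flat e_surj de dd F0]]]]|].
  have [k kE] : exists k : {linear F 1%N -> kernel e},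
      forall x, ker_incl e (k x) = d 0%N x.
    apply: (exact_lift (@ker_incl_inj _ _ _ e) (@ker_exact _ _ _ e)) => x.
    exact: exact_comp0.
  exists (kernel e), (F 0%N), (ker_incl e), e; split=> //.
    exact: ker_short_exact.
  exists (fun i => F i.+1), (fun i => d i.+1), k; split=> //.
  - move=> y; have /de[x dx] : e (ker_incl e y) = 0.
      exact: (exact_comp0 _ (@ker_exact _ _ _ e)).
    by exists x; apply: (@ker_incl_inj _ _ _ e); rewrite kE.
  - move=> y; rewrite -dd -kE; split=> [->|]; first by rewrite linear0.
    exact/inj_linear0/(@ker_incl_inj _ _ _ e).
  - by move=> i ni; apply: F0.
move=> [K [P [i [p [[i_inj p_surj ip] P_flat]]]]].
move=> [F [d [e [F_flat e_surj de dd F0]]]].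
pose G j : lmodType R := if j is j'.+1 then F j' else P.
pose dG j : {linear G j.+1 -> G j} :=
  if j is j'.+1 then d j' else (i \o e : {linear F 0%N -> P}).
exists G, dG, p; split=> //.
- by case.
- move=> y; rewrite ip; split=> [[x <-]|[x <-]]; last by exists (e x).
  by have [z <-] := e_surj x; exists z.
- case=> // y; rewrite -de /=; split=> [|->]; last by rewrite linear0.
  exact: inj_linear0.
- by case=> // j; apply: F0.
Qed.

Lemma flat_dim_leW M m n : (m <= n)%N -> flat_dim_le M m -> flat_dim_le M n.
Proof.
move=> mn [F [d [e [F_flat e_surj de dd F0]]]]; exists F, d, e; split=> // i ni.
by apply: F0; apply: leq_ltn_trans ni.
Qed.

Definition pmap_lin K L M N (f : {linear K -> M}) (g : {linear L -> N}) :
    {linear (K * L)%type -> (M * N)%type} :=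
  pair_lin (f \o fst_lin K L) (g \o snd_lin K L).

Lemma short_exact_prod K M N K' M' N' (f : {linear K -> M}) (g : {linear M -> N})
    (f' : {linear K' -> M'}) (g' : {linear M' -> N'}) :
  short_exact f g -> short_exact f' g' ->
  short_exact (pmap_lin f f') (pmap_lin g g').
Proof.
move=> [f_inj g_surj fg] [f'_inj g'_surj f'g']; split.
- by move=> [x x'] [y y'] [/f_inj -> /f'_inj ->].
- by move=> [y y']; have [x <-] := g_surj y; have [x' <-] := g'_surj y'; exists (x, x').
- move=> [y y']; split=> [[/fg[x <-] /f'g'[x' <-]]|[[x x'] [<- <-]]].
    by exists (x, x').
  exact: (congr2 pair (exact_comp0 x fg) (exact_comp0 x' f'g')).
Qed.

Lemma flat_dim_prod M N n :
  flat_dim_le M n -> flat_dim_le N n -> flat_dim_le (M * N)%type n.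
Proof.
elim: n M N => [|n IHn] M N.
  by move=> /flat_dim0P Mf /flat_dim0P Nf; apply/flat_dim0P/flat_prod.
move=> /flat_dimSP[K [P [i [p [ip Pf Kn]]]]].
move=> /flat_dimSP[L [Q [j [q [jq Qf Ln]]]]]; apply/flat_dimSP.
exists (K * L)%type, (P * Q)%type, (pmap_lin i j), (pmap_lin p q).
by split; [exact: short_exact_prod | exact: flat_prod | exact: IHn].
Qed.

(** Flat dimension passes to the kernel of a surjection onto a flat module. *)
Lemma flat_dim_kernel K M N (f : {linear K -> M}) (g : {linear M -> N}) n :
  short_exact f g -> flat N -> flat_dim_le M n -> flat_dim_le K n.
Proof.
move=> fg N_flat; case: n => [|n].
  by move=> /flat_dim0P M_flat; apply/flat_dim0P/(flat_kernel fg).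
case: fg => [f_inj g_surj fg].
move=> /flat_dimSP[L [P [i [p [[i_inj p_surj ip] P_flat Ln]]]]].
pose gp : {linear P -> N} := g \o p.
have gp_surj : surjective gp.
  by move=> z; have [y <-] := g_surj z; have [x <-] := p_surj y; exists x.
pose Q := kernel gp; have Q_flat : flat Q.
  exact: flat_kernel (ker_short_exact gp_surj) P_flat N_flat.
have [q qE] : exists q : {linear Q -> K}, forall x, f (q x) = p (ker_incl gp x).
  apply: (exact_lift f_inj fg (h := p \o ker_incl gp)) => x.
  exact: (exact_comp0 _ (@ker_exact _ _ _ gp)).
have [j jE] : exists j : {linear L -> Q}, forall x, ker_incl gp (j x) = i x.
  apply: (exact_lift (@ker_incl_inj _ _ _ gp) (@ker_exact _ _ _ gp)) => x.
  by rewrite /= (exact_comp0 _ ip) linear0.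
apply/flat_dimSP; exists L, Q, j, q; split=> //; split.
- by move=> x y jxy; apply: i_inj; rewrite -!jE jxy.
- move=> x; have [y py] := p_surj (f x).
  have /(@ker_exact _ _ _ gp)[z zy] : gp y = 0.
    by rewrite /= py (exact_comp0 _ fg).
  by exists z; apply: f_inj; rewrite qE zy.
- move=> x; split=> [qx|[y <-]].
    have /ip[y iy] : p (ker_incl gp x) = 0 by rewrite -qE qx linear0.
    by exists y; apply: (@ker_incl_inj _ _ _ gp); rewrite jE.
  by apply: f_inj; rewrite qE jE (exact_comp0 _ ip) linear0.
Qed.

(** The first syzygy of [M], for a surjection from a free module, has flat
    dimension at most [n] as soon as [M] has flat dimension at most [n.+1]. If
    [0 -> K -> P -> M -> 0] is exact with [P] flat, then a lift [h : F -> P] of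
    [e : F -> M] gives the exact sequence
    [0 -> ker e -> F * K -> P -> 0]. *)
Lemma flat_dim_syzygy (T : choiceType) M (e : {linear free_module R T -> M}) n :
  surjective e -> flat_dim_le M n.+1 -> flat_dim_le (kernel e) n.
Proof.
move=> e_surj /flat_dimSP[K [P [i [p [[i_inj p_surj ip] P_flat Kn]]]]].
set F := free_module R T in e e_surj *.
have [h hE] := free_projective e p_surj.
have [k kE] : exists k : {linear kernel e -> K},
    forall x, i (k x) = h (ker_incl e x).
  apply: (exact_lift i_inj ip (h := h \o ker_incl e)) => x.
  by rewrite /= hE (exact_comp0 _ (@ker_exact _ _ _ e)).
pose f : {linear kernel e -> (F * K)%type} := pair_lin (ker_incl e) k.
pose g : {linear (F * K)%type -> P} :=
  (h \o fst_lin F K) \- (i \o snd_lin F K).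
apply: (@flat_dim_kernel _ _ _ f g) P_flat _ => //.
  split.
  - by move=> x y [] /(@ker_incl_inj _ _ _ e).
  - move=> y; have [x ex] := e_surj (p y).
    have /ip[z iz] : p (h x - y) = 0 by rewrite linearB /= hE ex subrr.
    by exists (x, z); rewrite /= iz opprB addrC subrK.
  - move=> [x z]; split=> [/subr0_eq /= hx|[y [<- <-]]]; last first.
      by rewrite /= kE subrr.
    have /(@ker_exact _ _ _ e)[y yx] : e x = 0 by rewrite -hE hx (exact_comp0 _ ip).
    exists y; congr pair => //; apply: i_inj.
    by rewrite kE yx.
apply: flat_dim_prod => //; apply: (@flat_dim_leW _ 0) => //.
exact/flat_dim0P/free_flat.
Qed.

Lemma retract_kernel M N M' N' (f : {linear M -> N}) (f' : {linear M' -> N'})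
    (i : {linear M -> M'}) (p : {linear M' -> M})
    (j : {linear N -> N'}) (q : {linear N' -> N}) :
  (forall x, p (i x) = x) ->
  (forall x, f' (i x) = j (f x)) -> (forall x, f (p x) = q (f' x)) ->
  retract (kernel f) (kernel f').
Proof.
move=> pi ij pq.
have [u uE] : exists u : {linear kernel f -> kernel f'},
    forall x, ker_incl f' (u x) = i (ker_incl f x).
  apply: (exact_lift (@ker_incl_inj _ _ _ f') (@ker_exact _ _ _ f')
    (h := i \o ker_incl f)) => x.
  by rewrite /= ij (exact_comp0 _ (@ker_exact _ _ _ f)) linear0.
have [v vE] : exists v : {linear kernel f' -> kernel f},
    forall x, ker_incl f (v x) = p (ker_incl f' x).
  apply: (exact_lift (@ker_incl_inj _ _ _ f) (@ker_exact _ _ _ f)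
    (h := p \o ker_incl f')) => x.
  by rewrite /= pq (exact_comp0 _ (@ker_exact _ _ _ f')) linear0.
exists u, v => x; apply: (@ker_incl_inj _ _ _ f).
by rewrite vE uE pi.
Qed.

(** The canonical free cover is functorial, so the syzygy of a retract is a
    retract of the syzygy; by induction this reduces the statement to flat
    modules. *)
Lemma flat_dim_retract M N n :
  retract M N -> flat_dim_le N n -> flat_dim_le M n.
Proof.
elim: n M N => [|n IHn] M N.
  by move=> MN /flat_dim0P N_flat; apply/flat_dim0P/(flat_retract MN).
move=> [i [p pi]] Nn.
have [e eE] := free_lift (id : M -> M).
have [e' e'E] := free_lift (id : N -> N).
have e_surj : surjective e by move=> x; exists (fdelta R x).
have e'_surj : surjective e' by move=> x; exists (fdelta R x).
have [I IE] := free_lift (fun x => fdelta R (i x)).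
have [J JE] := free_lift (fun x => fdelta R (p x)).
apply/flat_dimSP; exists (kernel e), (free_module R M), (ker_incl e), e.
split; [exact: ker_short_exact | exact: free_flat |].
apply: IHn (flat_dim_syzygy e'_surj Nn).
apply: (@retract_kernel _ _ _ _ e e' I J i p).
- apply: (free_ext (f := J \o I) (f' := idfun)) => x.
  by rewrite /= IE JE pi.
- apply: (free_ext (f := e' \o I) (f' := i \o e)) => x.
  by rewrite /= IE e'E eE.
- apply: (free_ext (f := e \o J) (f' := p \o e')) => x.
  by rewrite /= JE e'E eE.
Qed.

End FlatDimension.

(** * Injective hulls *)

Section InjectiveHull.
Context (R : pzRingType).
Implicit Types (K L M N E J Q : lmodType R).

Lemma injective_retract J E : retract J E -> injective_module E -> injective_module J.
Proof.
move=> [i [p pi]] E_inj A B f g f_inj.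
have [h hf] := E_inj A B f (i \o g) f_inj.
by exists (p \o h) => a /=; rewrite hf /= pi.
Qed.

Lemma injective_prod E J :
  injective_module E -> injective_module J -> injective_module (E * J)%type.
Proof.
move=> E_inj J_inj A B f g f_inj.
have [h hf] := E_inj A B f (fst_lin E J \o g) f_inj.
have [k kf] := J_inj A B f (snd_lin E J \o g) f_inj.
by exists (pair_lin h k) => a; rewrite /= hf kf /=; case: (g a).
Qed.

Lemma essential_inj M E N (f : {linear M -> E}) (h : {linear E -> N}) :
  essential_image f -> (forall x, h (f x) = 0 -> f x = 0) -> injective h.
Proof.
move=> f_ess hf; apply: inj_linear => x hx; apply/eqP/negP => /negP x0.
have [||m] := f_ess (ker_pred h); first exact: ker_submod_closed.
  by exists x => //; apply/eqP.
by move=> /eqP /hf ->; rewrite eqxx.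
Qed.

(** Among the submodules that meet [S] only in zero there is a maximal one, by
    Zorn's lemma. *)
Lemma max_complement E (S : {pred E}) : exists C : {pred E},
  [/\ GRing.submod_closed C,
      forall x, x \in C -> x \in S -> x = 0
    & forall D : {pred E}, GRing.submod_closed D ->
        (forall x, x \in C -> x \in D) ->
        (forall x, x \in D -> x \in S -> x = 0) ->
        forall x, x \in D -> x \in C].
Proof.
(* [T] does not require [A 0], so as to hold for the union of the empty chain *)
pose T (A : set E) := (forall a x y, A x -> A y -> A (a *: x + y)) /\
  (forall x, A x -> x \in S -> x = 0).
have [|A [[A_lin AS] A_max]] := @Zorn_bigcup E T.
  move=> F FT F_tot; split=> [a x y [X FX Xx] [Y FY Yy]|x [X FX Xx]]; last first.
    by have [_] := FT _ FX; apply.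
  have [XY|YX] := F_tot _ _ FX FY.
    by exists Y => //; have [lin _] := FT _ FY; apply: lin => //; apply: XY.
  by exists X => //; have [lin _] := FT _ FX; apply: lin => //; apply: YX.
have A_ge (B : set E) : T B -> (A `<=` B)%classic -> (B `<=` A)%classic.
  move=> TB AB; apply: contrapT => BA.
  by apply: (A_max B) => //; rewrite properE.
have A0 : A 0.
  apply: contrapT => nA0; apply: (nA0); apply: (A_ge [set 0]%classic) => //.
    split=> [a x y -> ->|x -> //]; by rewrite scaler0 addr0.
  move=> x Ax; exfalso; apply: nA0.
  by have := A_lin (-1) x x Ax Ax; rewrite scaleN1r addNr.
exists (fun x => `[< A x >]); split.
- split=> [|a x y /asboolP Ax /asboolP Ay]; apply/asboolP => //.
  exact: A_lin.
- by move=> x /asboolP; apply: AS.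
- move=> D [D0 D_lin] AD DS x Dx; apply/asboolP.
  apply: (A_ge (fun x => x \in D)) => //.
  by move=> y Ay; apply: AD; apply/asboolP.
Qed.

(** If [C] is a maximal submodule of [E] meeting [M] only in zero, then [M] is
    an essential submodule of [Q = E / C]. *)
Lemma essential_max_complement M E (f : {linear M -> E}) (C : {pred E}) Q
    (q : {linear E -> Q}) :
  injective f -> surjective q -> (forall x, q x = 0 <-> x \in C) ->
  (forall x, x \in C -> x \in im_pred f -> x = 0) ->
  (forall D : {pred E}, GRing.submod_closed D ->
        (forall x, x \in C -> x \in D) ->
        (forall x, x \in D -> x \in im_pred f -> x = 0) ->
        forall x, x \in D -> x \in C) ->
  injective (q \o f) /\ essential_image (q \o f : {linear M -> Q}).
Proof.
move=> f_inj q_surj q0 C_compl C_max.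
have fE m : f m \in im_pred f by apply/asboolP; exists m.
split.
  apply: inj_linear => m /= /q0 fm; apply: (inj_linear0 f_inj).
  exact: C_compl.
move=> S [S0 S_lin] [z zS z0]; have [x qx] := q_surj z.
apply: contrapT => S_f; move/negP: z0; apply; rewrite -qx; apply/eqP/q0.
apply: (C_max (fun y => q y \in S)).
- split=> [|a y y']; first by rewrite unfold_in linear0.
  by rewrite !unfold_in linearP => yS y'S; apply: S_lin.
- by move=> y /q0 qy; rewrite unfold_in qy.
- move=> y yS /asboolP[m fm]; apply: contrapT => y0; apply: S_f.
  exists m; rewrite /= fm //; apply/eqP => /q0 yC; apply: y0.
  by apply: C_compl => //; rewrite -fm.
- by rewrite unfold_in qx.
Qed.

(** A submodule [M] of an injective module [E] has an injective hull: with [C]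
    maximal among the submodules meeting [M] only in zero, the hull is [E /
    C]. It is injective because [C] is a direct summand of [E]. Indeed, let
    [D] be maximal among the submodules meeting [C] only in zero; then [C] is
    essential in [E / D], the inclusion of [C] extends to an injection [h : E
    / D -> E], the image of [h] still meets [M] trivially, hence is [C], and
    [E -> E / D -> C] is a retraction. *)
Lemma injective_hull M E (f : {linear M -> E}) :
  injective f -> injective_module E ->
  exists J (j : {linear M -> J}),
    [/\ injective_module J, injective j & essential_image j].
Proof.
move=> f_inj E_inj.
have [C [C_clos C_compl C_max]] := max_complement (im_pred f).
have [Q [q [q_surj q0]]] := quotient_module C_clos.
have [j_inj j_ess] := essential_max_complement f_inj q_surj q0 C_compl C_max.
exists Q, (q \o f : {linear M -> Q}); split=> //.
pose c := ker_incl q.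
have [D [D_clos D_compl D_max]] := max_complement (im_pred c).
have [Q' [q' [q'_surj q'0]]] := quotient_module D_clos.
have [c_inj c_ess] := essential_max_complement
  (@ker_incl_inj _ _ _ q) q'_surj q'0 D_compl D_max.
have [h hE] := E_inj _ _ (q' \o c : {linear kernel q -> Q'}) c c_inj.
have h_inj : injective h.
  apply: essential_inj c_ess _ => x; rewrite hE => cx.
  by rewrite -[LHS]/(q' (c x)) cx linear0.
have hC z : h z \in C.
  apply: (C_max (im_pred h)); last by apply/asboolP; exists z.
  - split=> [|a _ _ /asboolP[x <-] /asboolP[y <-]]; apply/asboolP.
      by exists 0; rewrite linear0.
    by exists (a *: x + y); rewrite linearP.
  - move=> x /q0 /(@ker_exact _ _ _ q)[y yx].
    by apply/asboolP; exists (q' (c y)); rewrite hE.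
  - move=> _ /asboolP[x <-] hx; apply: contrapT => x0.
    have [||y] := c_ess (fun z => h z \in im_pred f).
    + split=> [|a u v]; rewrite !unfold_in.
        by rewrite linear0; apply/asboolP; exists 0; rewrite linear0.
      rewrite linearP => /asboolP[m <-] /asboolP[n <-].
      by apply/asboolP; exists (a *: m + n); rewrite linearP.
    + by exists x => //; apply/eqP => x0'; apply: x0; rewrite x0' linear0.
    + rewrite unfold_in hE => cyf /eqP; apply.
      have cy0 : c y = 0.
        by apply: C_compl cyf; apply/q0/(exact_comp0 _ (@ker_exact _ _ _ q)).
      by rewrite -[LHS]/(q' (c y)) cy0 linear0.
pose r : {linear E -> E} := (idfun : {linear E -> E}) \- (h \o q').
have [s sE] : exists s : {linear Q -> E}, forall x, s (q x) = r x.
  apply: (exact_factor q_surj (@ker_exact _ _ _ q)) => x.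
  by rewrite /r /= (hE x : h (q' (ker_incl q x)) = _) subrr.
apply: (injective_retract (E := E)) => //; exists s, q => z.
have [x <-] := q_surj z.
by rewrite sE /r linearB /= (proj2 (q0 _) (hC _)) subr0.
Qed.

End InjectiveHull.

(** * Injective coresolutions with flat dimension bounds *)

Section Coresolutions.
Context (R : pzRingType).
Implicit Types (M N E J P Q U V W X Z : lmodType R).

(** There is an exact sequence [0 -> M -> E_0 -> ... -> E_(k-1)], not
    necessarily minimal, with every [E_i] injective and of flat dimension at
    most [s + i]. It is built one cokernel [Q] at a time. *)
Fixpoint bounded_coresolution (k s : nat) M : Prop :=
  if k is k'.+1 then
    exists E Q (f : {linear M -> E}) (q : {linear E -> Q}),
      [/\ short_exact f q, injective_module E, flat_dim_le E s
        & bounded_coresolution k' s.+1 Q]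
  else True.

Lemma bounded_coresolution_leW k s t M : (s <= t)%N ->
  bounded_coresolution k s M -> bounded_coresolution k t M.
Proof.
elim: k s t M => // k IHk s t M st [E [Q [f [q [fq E_inj Es Qk]]]]].
exists E, Q, f, q; split=> //; first exact: flat_dim_leW Es.
by apply: IHk Qk; rewrite ltnS.
Qed.

(** The horseshoe lemma. *)
Lemma bounded_coresolution_ext k s W V U (f : {linear W -> V})
    (g : {linear V -> U}) :
  short_exact f g -> bounded_coresolution k s W -> bounded_coresolution k s U ->
  bounded_coresolution k s V.
Proof.
elim: k s W V U f g => // k IHk s W V U f g [f_inj g_surj fg].
move=> [E [Q [w [q [[w_inj q_surj wq] E_inj Es Qk]]]]].
move=> [E' [Q' [u [q' [[u_inj q'_surj uq'] E'_inj E's Q'k]]]]].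
have [h hf] := E_inj _ _ f w f_inj.
pose v : {linear V -> (E * E')%type} := pair_lin h (u \o g).
have [P [p [p_surj vp]]] := cokernel v.
exists (E * E')%type, P, v, p; split; [split=> // | | |].
- apply: inj_linear => x [hx /(inj_linear0 u_inj)/fg[y yx]].
  by rewrite -yx (inj_linear0 (x := y) w_inj) ?linear0 // -hf yx.
- exact: injective_prod.
- exact: flat_dim_prod.
have [a aE] : exists a : {linear Q -> P}, forall x, a (q x) = p (inl_lin E E' x).
  apply: (exact_factor q_surj wq (h := p \o inl_lin E E')) => y /=.
  apply/vp; exists (f y).
  by rewrite /= hf (exact_comp0 _ fg) linear0.
have [b bE] : exists b : {linear P -> Q'}, forall x, b (p x) = q' (snd_lin E E' x).
  apply: (exact_factor p_surj vp (h := q' \o snd_lin E E')) => y /=.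
  exact: exact_comp0 uq'.
apply: (IHk _ _ _ _ a b) Qk Q'k; split.
- apply: inj_linear => z; have [x <-] := q_surj z.
  rewrite aE => /vp[y [hy /(inj_linear0 u_inj)/fg[m my]]].
  by apply/wq; exists m; rewrite -hf my.
- move=> z; have [y <-] := q'_surj z.
  by exists (p (0, y)); rewrite bE.
- move=> z; have [[x y] <-] := p_surj z; rewrite bE; split=> [/uq'[c cy]|].
    have [d dc] := g_surj c; exists (q (x - h d)).
    rewrite aE -[RHS]subr0 -(exact_comp0 d vp) -linearB; congr (p _).
    by rewrite /= dc cy -[RHS]/(x - h d, y - y) subrr.
  move=> [m]; have [x' <-] := q_surj m; rewrite aE => /(congr1 b).
  by rewrite !bE /= linear0.
Qed.

(** A module [Z] embedded in [X] with cokernel [W] has the coresolution given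
    by [E_0(X)] followed by a coresolution of an extension of [E_0(X) / X] by
    [W]. Note the shift by one in the bound for [W]. *)
Lemma bounded_coresolution_kernel k s Z X W (f : {linear Z -> X})
    (g : {linear X -> W}) :
  short_exact f g -> bounded_coresolution k.+1 s X ->
  bounded_coresolution k s.+1 W -> bounded_coresolution k.+1 s Z.
Proof.
move=> [f_inj g_surj fg] [E [Q [e [q [[e_inj q_surj eq] E_inj Es Qk]]]]] Wk.
pose ef : {linear Z -> E} := e \o f.
have [P [p [p_surj efp]]] := cokernel ef.
exists E, P, ef, p; split=> //; first by split=> // x y /e_inj/f_inj.
have [a aE] : exists a : {linear W -> P}, forall x, a (g x) = p (e x).
  by apply: (exact_factor g_surj fg (h := p \o e)) => y; apply/efp; exists y.
have [b bE] : exists b : {linear P -> Q}, forall x, b (p x) = q x.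
  by apply: (exact_factor p_surj efp (h := q)) => y; apply: exact_comp0 eq.
apply: (@bounded_coresolution_ext _ _ _ _ _ a b) Wk Qk; split.
- apply: inj_linear => z; have [x <-] := g_surj z.
  by rewrite aE => /efp[m /e_inj <-]; apply: exact_comp0.
- by move=> z; have [y <-] := q_surj z; exists (p y); rewrite bE.
- move=> z; have [y <-] := p_surj z; rewrite bE; split=> [/eq[x xy]|[w]].
    by exists (g x); rewrite aE xy.
  have [x <-] := g_surj w; rewrite aE => /(congr1 b).
  by rewrite !bE (exact_comp0 _ eq).
Qed.

(** If [M] is a retract of [N], then the hull [J] of [M] is a retract of any
    injective module [E] containing [N], and [P = J / M] is a retract of
    [Q = E / N]. *)
Lemma retract_hull M N J P E Q (j : {linear M -> J}) (r : {linear J -> P})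
    (e : {linear N -> E}) (q : {linear E -> Q}) :
  retract M N -> short_exact j r -> short_exact e q ->
  injective_module J -> essential_image j -> injective_module E ->
  retract J E /\ retract P Q.
Proof.
move=> [i [p pi]] [j_inj r_surj jr] [e_inj q_surj eq] J_inj j_ess E_inj.
have [u uj] := E_inj _ _ j (e \o i) j_inj.
have [v ve] := J_inj _ _ e (j \o p) e_inj.
(* [v \o u] fixes [M], hence is injective, and thus has a left inverse *)
have vu_inj : injective (v \o u : {linear J -> J}).
  by apply: (essential_inj j_ess) => x /=; rewrite uj /= ve /= pi.
have [w wvu] := J_inj _ _ (v \o u : {linear J -> J}) idfun vu_inj.
pose v' : {linear E -> J} := w \o v.
have v'u x : v' (u x) = x by exact: wvu.
have v'e y : v' (e y) = j (p y).
  rewrite -[RHS]wvu -[LHS]/(w (v (e y))) ve.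
  by rewrite -[RHS]/(w (v (u (j (p y))))) uj /= ve /= pi.
split; first by exists u, v'.
have [a aE] : exists a : {linear P -> Q}, forall x, a (r x) = q (u x).
  apply: (exact_factor r_surj jr (h := q \o u)) => x.
  by rewrite /= uj /= (exact_comp0 _ eq).
have [b bE] : exists b : {linear Q -> P}, forall x, b (q x) = r (v' x).
  apply: (exact_factor q_surj eq (h := r \o v')) => x.
  by rewrite -[LHS]/(r (v' (e x))) v'e (exact_comp0 _ jr).
by exists a, b => x; have [y <-] := r_surj x; rewrite aE bE v'u.
Qed.

Lemma bounded_coresolution_retract k s M N :
  retract M N -> bounded_coresolution k s N -> bounded_coresolution k s M.
Proof.
elim: k s M N => // k IHk s M N MN [E [Q [e [q [eq E_inj Es Qk]]]]].
have [e_inj _ _] := eq; have [i [p pi]] := MN.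
have ei_inj : injective (e \o i : {linear M -> E}).
  by move=> x y /e_inj xy; rewrite -(pi x) -(pi y) xy.
have [J [j [J_inj j_inj j_ess]]] := injective_hull ei_inj E_inj.
have [P [r [r_surj jr]]] := cokernel j.
have jrS : short_exact j r by [].
have [JE PQ] := retract_hull MN jrS eq J_inj j_ess E_inj.
exists J, P, j, r; split=> //; first exact: flat_dim_retract Es.
exact: IHk Qk.
Qed.

(** One step of the minimal injective coresolution of [M]: an injective hull of
    flat dimension at most [s], and its cokernel, which again has bounded
    coresolutions of every length. *)
Record hull_step (s : nat) M := HullStep {
  hull : lmodType R;
  cosyz : lmodType R;
  hull_in : {linear M -> hull};
  hull_out : {linear hull -> cosyz};
  hull_exact : short_exact hull_in hull_out;
  hull_injective : injective_module hull;
  hull_essential : essential_image hull_in;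
  hull_flat_dim : flat_dim_le hull s;
  cosyzP : forall k, bounded_coresolution k s.+1 cosyz }.

Lemma hull_step_exists s M :
  (forall k, bounded_coresolution k s M) -> exists _ : hull_step s M, True.
Proof.
move=> Mk; have [E [Q [e [q [[e_inj _ _] E_inj _ _]]]]] := Mk 1%N.
have [J [j [J_inj j_inj j_ess]]] := injective_hull e_inj E_inj.
have [P [r [r_surj jr]]] := cokernel j.
have jrS : short_exact j r by [].
have MM : retract M M by exists idfun, idfun.
have Jk k : flat_dim_le J s /\ bounded_coresolution k s.+1 P.
  have [E' [Q' [e' [q' [e'q' E'_inj E's Q'k]]]]] := Mk k.+1.
  have [JE PQ] := retract_hull MM jrS e'q' J_inj j_ess E'_inj.
  split; first exact: flat_dim_retract E's.
  exact: bounded_coresolution_retract Q'k.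
by exists (HullStep jrS J_inj j_ess (proj1 (Jk 0%N)) (fun k => proj2 (Jk k))).
Qed.

(** The minimal coresolution is obtained by iterating [hull_step], with a
    choice of hull at each step. *)
Lemma bounded_coresolution_auslander M :
  (forall k, bounded_coresolution k 0 M) -> auslander_condition M.
Proof.
move=> Mk.
pose step s N (Nk : forall k, bounded_coresolution k s N) : hull_step s N :=
  sval (cid (hull_step_exists Nk)).
pose fix Z i : {N : lmodType R | forall k, bounded_coresolution k i N} :=
  if i is i'.+1 then
    exist _ (cosyz (step i' _ (svalP (Z i')))) (cosyzP (step i' _ (svalP (Z i'))))
  else exist _ M Mk.
pose st i := step i _ (svalP (Z i)).
pose d i : {linear hull (st i) -> hull (st i.+1)} :=
  hull_in (st i.+1) \o hull_out (st i).
have dE i y : d i y = 0 <-> hull_out (st i) y = 0.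
  rewrite /d /=; split=> [|->]; last by rewrite linear0.
  by case: (hull_exact (st i.+1)) => + _ _; apply: inj_linear0.
exists (fun i => hull (st i)), (hull_in (st 0%N)), d.
split; last by move=> i; exact: hull_flat_dim.
split; last split.
- by move=> i; exact: hull_injective.
- by case: (hull_exact (st 0%N)).
- by move=> y; rewrite dE; case: (hull_exact (st 0%N)) => _ _; apply.
- move=> i y; rewrite dE; case: (hull_exact (st i.+1)) => _ _ ->.
  split=> [[x <-]|[x <-]]; last by exists (hull_out (st i) x).
  by case: (hull_exact (st i)) => _ /(_ x)[z <-] _; exists z.
- exact: hull_essential.
- move=> i S S_clos /(@hull_essential _ _ (st i.+1) _ S_clos)[m mS m0].
  case: (hull_exact (st i)) => _ /(_ m)[z zm] _.
  by exists z; rewrite /d /= zm.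
Qed.

(** If the sequence [M -> N -> P] is exact at [N], then [f] corestricts to a
    surjection onto the kernel of [g]. *)
Lemma exact_corestrict M N P (f : {linear M -> N}) (g : {linear N -> P}) :
  exact_at f g -> exists q : {linear M -> kernel g},
    surjective q /\ forall x, q x = 0 <-> f x = 0.
Proof.
move=> fg.
have [q qE] : exists q : {linear M -> kernel g}, forall x, ker_incl g (q x) = f x.
  apply: (exact_lift (@ker_incl_inj _ _ _ g) (@ker_exact _ _ _ g)) => x.
  exact: exact_comp0.
exists q; split=> x; last first.
  rewrite -qE; split=> [->|]; first by rewrite linear0.
  exact/inj_linear0/(@ker_incl_inj _ _ _ g).
have /fg[y yx] : g (ker_incl g x) = 0 by exact: (exact_comp0 _ (@ker_exact _ _ _ g)).
by exists y; apply: (@ker_incl_inj _ _ _ g); rewrite qE.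
Qed.

Lemma auslander_bounded_coresolution M k :
  auslander_condition M -> bounded_coresolution k 0 M.
Proof.
move=> [E [eta [d [[E_inj eta_inj eta_d dd _] Efd]]]]; case: k => // k.
have dk i : bounded_coresolution k i.+1 (kernel (d i.+1)).
  elim: k i => // k IHk i.
  have [q [q_surj q0]] := exact_corestrict (dd i.+1).
  exists (E i.+1), (kernel (d i.+2)), (ker_incl (d i.+1)), q; split=> //.
  by split=> // y; rewrite q0; exact: ker_exact.
have [q [q_surj q0]] := exact_corestrict (dd 0%N).
exists (E 0%N), (kernel (d 1%N)), eta, q; split=> //.
by split=> // y; rewrite q0; exact: eta_d.
Qed.

End Coresolutions.

(* Here [d n] is the differential X_(n+1) -> X_n. *)
Theorem proposition3p2 (R : pzRingType) (X : int -> lmodType R)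
    (d : forall n : int, {linear X (n + 1) -> X n})
    (d_exact : forall n : int, exact_at (d (n + 1)) (d n))
    (X_AC : forall n : int, auslander_condition (X n)) :
  forall n : int, auslander_condition (kernel (d n)).
Proof.
move=> n; apply: bounded_coresolution_auslander => k.
elim: k n => // k IHk n.
(* [d_exact m] is about [d (m + 1)], so [n] must have this form *)
have [m ->] : exists m : int, n = m + 1 by exists (n - 1); rewrite subrK.
have [q [q_surj q0]] := exact_corestrict (d_exact m).
apply: (@bounded_coresolution_kernel _ _ _ _ _ _ (ker_incl (d (m + 1))) q).
- by split=> // y; rewrite q0; exact: ker_exact.
- exact: auslander_bounded_coresolution.
- exact: (bounded_coresolution_leW (leq0n 1) (IHk m)).
Qed.
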